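(* Let $(X,T)$ be a topological dynamical system which is $LYS$. Let $Dist\subseteq X\times X$ be the set of distal pairs. Assume there is a nonempty open set $H\subset X$ such that $(H\times H)\cap Dist$ has empty interior or (equivalently) that $(H\times H)\cap Dist$ is a set of the first Baire category. Then there is an $\varepsilon>0$ such that $(X,T)$ is $LYC_\varepsilon$.
   Context: A topological dynamical system $(X,T)$ is a compact metric space $(X,\rho)$ with a continuous surjective map $T:X\to X$. A pair $(x,y)\in X\times X$ is distal if $\liminf_{n\to\infty}\rho(T^n(x),T^n(y))>0$. It is an $\varepsilon$-Li-Yorke pair if $\liminf_{n\to\infty}\rho(T^n(x),T^n(y))=0$ and $\limsup_{n\to\infty}\rho(T^n(x),T^n(y))>\varepsilon$. $(X,T)$ is Li-Yorke sensitive, $LYS$, if there is $\varepsilon>0$ such that every $x\in X$ is a limit of points $y\in X$ such that $(x,y)$ is an $\varepsilon$-Li-Yorke pair. $(X,T)$ is $LYC_\varepsilon$ (Li-Yorke chaotic) if there is an uncountable set $D\subseteq X$ such that any two distinct points of $D$ form an $\varepsilon$-Li-Yorke pair. *)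

(* Defs.v *)
From HB Require Import structures.
From mathcomp Require Import all_boot all_order all_algebra.
From mathcomp Require Import all_classical all_reals all_analysis.

Set Implicit Arguments.
Unset Strict Implicit.
Unset Printing Implicit Defensive.

Import Order.TTheory GRing.Theory Num.Theory.
Import numFieldNormedType.Exports.

Local Open Scope classical_set_scope.
Local Open Scope ring_scope.

Definition nowhere_dense (U : topologicalType) (A : set U) : Prop :=
  interior (closure A) = set0.

Definition first_category (U : topologicalType) (A : set U) : Prop :=
  exists2 F : (set U)^nat,
    (forall n, nowhere_dense (F n)) & A = \bigcup_n F n.

Section Dynamics.
Context {R : realType} {X : metricType R}.
Implicit Types (T : X -> X) (x y : X) (eps : R).

Definition topological_dynamical_system T : Prop :=
  [/\ compact [set: X], continuous T & set_surj [set: X] [set: X] T].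

(* Extended-real valued, so that the limits inferior and superior below are
   meaningful without a boundedness side condition. *)
Definition orbit_dist T x y (n : nat) : \bar R :=
  (mdist (iter n T x) (iter n T y))%:E.

Definition distal_pair T x y : Prop :=
  (0%:E < limn_einf (orbit_dist T x y))%E.

Definition Dist T : set (X * X) := [set p | distal_pair T p.1 p.2].

Definition Li_Yorke_pair T eps x y : Prop :=
  limn_einf (orbit_dist T x y) = 0%:E /\
  (eps%:E < limn_esup (orbit_dist T x y))%E.

Definition LYS T : Prop :=
  exists2 eps, 0 < eps & forall x, exists2 u : nat -> X,
    (forall n, Li_Yorke_pair T eps x (u n)) & u n @[n --> \oo] --> x.

Definition LYC T eps : Prop :=
  exists2 D : set X, ~ countable D &
    forall x y, D x -> D y -> x <> y -> Li_Yorke_pair T eps x y.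

End Dynamics.

(* Main.v *)
Require Import Defs.
From HB Require Import structures.
From mathcomp Require Import all_boot all_order all_algebra.
From mathcomp Require Import all_classical all_reals all_analysis.
From mathcomp Require Import lra.

Set Implicit Arguments.
Unset Strict Implicit.
Unset Printing Implicit Defensive.

Import Order.TTheory GRing.Theory Num.Theory.
Import numFieldNormedType.Exports.

Local Open Scope classical_set_scope.
Local Open Scope ring_scope.

(** Two points of [X] fail to be distal exactly when, for every [k], their
    orbits come within [1/(k+1)] of each other at some time [n >= k]
    ([late_close]); these are open conditions, so [Dist] is an F_sigma set
    ([DistE]). A relatively closed piece of [H `*` H] with empty interior is
    nowhere dense, whereas by Baire's theorem in the compact space [X * X] a
    meager set has empty interior; hence the two smallness conditions on
    [(H `*` H) `&` Dist] are equivalent.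

    Let [eps] be a constant of Li-Yorke sensitivity. Given [(x, y)] and a point
    [z] close to [y] with [(y, z)] an [eps]-Li-Yorke pair, the orbits of [y] and
    [z] are more than [eps] apart at arbitrarily late times, so by the triangle
    inequality at such a time the orbit of [x] is more than [eps / 2] away from
    that of [y] or from that of [z]. Thus the open set [late_apart T (eps / 2) k]
    is dense for every [k] ([LYS_late_apart_dense]). If [Dist] has empty
    interior in [H `*` H], the sets [late_close T k] are also dense there, so
    the intersection [E] of all these sets is comeager in [H `*` H], and any
    pair in it is [eps / 4]-Li-Yorke.

    It remains to find an uncountable set all of whose pairs of distinct points
    lie in the symmetric comeager relation [E] ([uncountable_free_set], a weak
    form of Mycielski's theorem). By Kuratowski-Ulam, comeagerly many [x] in [H]
    have a comeager section of [E]. Zorn's lemma gives a maximal set [D] of such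
    points with all pairs of distinct points in [E]. Were [D] countable, the
    sections over [D] would have a common point [y] in [H] whose own section is
    comeager; since [E] is irreflexive, [y] is new, and [D] could be enlarged. *)

(** * Comeager subsets of an open set *)

Definition dense_in (Y : topologicalType) (U A : set Y) : Prop :=
  forall V, open V -> V `<=` U -> V !=set0 -> V `&` A !=set0.

(** The family is a countable set rather than a sequence so that countable
    intersections reduce to countable unions of families, without pairing
    indices. *)
Definition comeager_in (Y : topologicalType) (U A : set Y) : Prop :=
  exists2 G : set (set Y),
    countable G /\ (forall O, G O -> open O /\ dense_in U O) &
    forall x, U x -> (forall O, G O -> O x) -> A x.

Section Comeager.
Variables (Y : topologicalType) (U : set Y).

Lemma comeager_inS (A B : set Y) :
  A `<=` B -> comeager_in U A -> comeager_in U B.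
Proof.
by move=> AB [G hG GA]; exists G => // x Ux Gx; exact/AB/GA.
Qed.

Lemma open_dense_comeager_in (O : set Y) :
  open O -> dense_in U O -> comeager_in U O.
Proof.
move=> oO dO; exists [set O]; first by split; [exact: countable1|move=> _ ->].
by move=> x _; apply.
Qed.

Lemma comeager_in_bigcap (I : Type) (D : set I) (A : I -> set Y) :
  countable D -> (forall i, D i -> comeager_in U (A i)) ->
  comeager_in U (\bigcap_(i in D) A i).
Proof.
move=> cD cA.
have /choice[G hG] : forall i, exists G : set (set Y), D i ->
    [/\ countable G, forall O, G O -> open O /\ dense_in U O &
      forall x, U x -> (forall O, G O -> O x) -> A i x].
  move=> i; have [Di|nDi] := pselect (D i); last by exists set0.
  by have [G [cG oG] GA] := cA i Di; exists G.
exists (\bigcup_(i in D) G i).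
  split; first by apply: bigcup_countable => // i Di; have [] := hG i Di.
  by move=> O [i Di GO]; have [_ + _] := hG i Di; apply.
move=> x Ux Gx i Di; have [_ _] := hG i Di; apply => // O GO.
by apply: Gx; exists i.
Qed.

Lemma comeager_inI (A B : set Y) :
  comeager_in U A -> comeager_in U B -> comeager_in U (A `&` B).
Proof.
move=> cA cB; have : comeager_in U (\bigcap_(b in [set: bool]) if b then A else B).
  by apply: comeager_in_bigcap => // -[].
by apply: comeager_inS => x h; split; [exact: (h true)|exact: (h false)].
Qed.

End Comeager.

(** * Baire's theorem in compact uniform spaces *)

Section Baire.
Variable Y : uniformType.
Hypothesis Y_compact : compact [set: Y].

(** One step of the Baire construction: regularity of uniform spaces leaves room
    for a closed neighbourhood inside the open set [V `&` A]. *)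
Lemma dense_in_shrink (U V A : set Y) :
  open A -> dense_in U A -> open V -> V `<=` U -> V !=set0 ->
  exists W, [/\ open W, W !=set0 & closure W `<=` V `&` A].
Proof.
move=> oA dA oV VU V0; have [x [Vx Ax]] := dA V oV VU V0.
have : nbhs x (V `&` A) by apply: open_nbhs_nbhs; split => //; exact: openI.
move=> /uniform_regular[W Wx WVA]; exists W°; split.
- exact: open_interior.
- by exists x.
- by apply: subset_trans WVA; apply: closureS; exact: interior_subset.
Qed.

(** Shrink [U] successively through the [A n], the closure of each new open set
    lying in the previous one; compactness gives a cluster point of the nested
    sequence, which then lies in all of them. *)
Lemma baire_compact_seq (U : set Y) (A : nat -> set Y) :
  open U -> U !=set0 -> (forall n, open (A n) /\ dense_in U (A n)) ->
  U `&` \bigcap_n A n !=set0.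
Proof.
move=> oU U0 hA.
(* A state is an index together with the current nonempty open subset of [U];
   the index tells which [A n] the next step has to enter. *)
pose good (nV : nat * set Y) :=
  [/\ open nV.2, nV.2 !=set0 & nV.2 `<=` U].
pose step (s t : {nV | good nV}) :=
  (sval t).1 = (sval s).1.+1 /\
  closure (sval t).2 `<=` (sval s).2 `&` A (sval s).1.
have steps s : {t | step s t}.
  apply: cid; case: s => -[n V] /= [/= oV V0 VU].
  have [oA dA] := hA n.
  have [W [oW W0 WVA]] := dense_in_shrink oA dA oV VU V0.
  have gW : good (n.+1, W).
    by split => //= x /(@subset_closure _ W)/WVA[/VU].
  by exists (exist _ _ gW).
have gU : good (0%N, U) by split.
have [f [f0 fS]] := dependent_choice steps (exist _ _ gU).
pose V n := (sval (f n)).2.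
have fn n : (sval (f n)).1 = n.
  by elim: n => [|n ih]; rewrite ?f0//; have [-> _] := fS n; rewrite ih.
have VS n : closure (V n.+1) `<=` V n `&` A n.
  by have [_] := fS n; rewrite fn.
have Vle m n : (m <= n)%N -> V n `<=` V m.
  elim: n => [|n ih]; first by rewrite leqn0 => /eqP ->.
  rewrite leq_eqVlt => /orP[/eqP->//|/ih nm].
  by move=> x /(@subset_closure _ (V n.+1))/VS[/nm].
have V0 n : V n !=set0 by rewrite /V; case: (f n) => -[k W] [].
pose F : set_system Y := filter_from [set: nat] V.
have PF : ProperFilter F.
  apply: filter_from_proper => //; apply: filter_from_filter; first by exists 0%N.
  move=> i j _ _; exists (maxn i j) => // x Vx.
  by split; apply: Vle Vx; [exact: leq_maxl|exact: leq_maxr].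
have [x [_ clx]] := Y_compact PF filterT.
have Vx n : closure (V n) x by move=> B Bx; apply: clx Bx; exists n.
exists x; split; last by move=> n _; have [] := VS n x (Vx n.+1).
by have [+ _] := VS 0%N x (Vx 1%N); rewrite /V f0.
Qed.

Lemma comeager_in_nonempty (U A : set Y) :
  open U -> U !=set0 -> comeager_in U A -> U `&` A !=set0.
Proof.
move=> oU U0 [G [cG hG] GA].
(* Adding the full space makes the family nonempty, hence the range of a
   sequence. *)
have cG' : countable (G `|` [set setT]).
  have -> : G `|` [set setT] = \bigcup_(b in [set: bool]) if b then G else [set setT].
    apply/seteqP; split => [W [GW|WT]|W [[] _ GW]].
    - by exists true.
    - by exists false.
    - by left.
    - by right.
  by apply: bigcup_countable => // -[] _ //; exact: countable1.
have [G0|[f]] : G `|` [set setT] = set0 \/ $|{surjfun [set: nat] >-> G `|` [set setT]}|.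
  exact/pfcard_geP.
- by have : (G `|` [set setT]) setT by [right]; rewrite G0.
have hf n : open (f n) /\ dense_in U (f n).
  have [/hG//|->] : (G `|` [set setT]) (f n) by exact: funS.
  by split; [exact: openT|move=> V _ _ [x Vx]; exists x].
have [x [Ux fx]] := baire_compact_seq oU U0 hf.
exists x; split => //; apply: GA => // O GO.
have [n _ <-] : [set f n | n in [set: nat]] O by apply: surj; left.
exact: fx.
Qed.

End Baire.

(** * The Kuratowski-Ulam theorem and free sets *)

(** The point [x0] only serves to equip [X] with a pointed structure. *)
Lemma compact_pseudometric_second_countable (R : realType)
    (X : pseudoMetricType R) (x0 : X) :
  compact [set: X] -> @second_countable X.
Proof.
pose Xp : pseudoPMetricType R := HB.pack (X : Type) X (isPointed.Build X x0).
exact: (@compact_second_countable R Xp).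
Qed.

Section KuratowskiUlam.
Variables (X : topologicalType) (H : set X).
Hypothesis X_sc : @second_countable X.

(** The section of [W] at [x] is dense in [H] as soon as it meets every nonempty
    basic open [b `<=` H], that is, as soon as [x] lies in the projection of
    [W `&` (H `*` b)]; each of these countably many projections is open and, [W]
    being dense, is dense in [H]. *)
Lemma comeager_dense_sections (W : set (X * X)) :
  open W -> dense_in (H `*` H) W ->
  comeager_in H [set x | open (xsection W x) /\ dense_in H (xsection W x)].
Proof.
move=> oW dW; have [B cB [oB bB]] := X_sc.
pose D := [set b | B b /\ b `<=` H /\ b !=set0].
pose P (b : set X) := [set x | exists2 y, b y & W (x, y)].
have nW x y : W (x, y) -> exists2 QR : set X * set X,
    nbhs x QR.1 /\ nbhs y QR.2 & QR.1 `*` QR.2 `<=` W.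
  by move=> Wxy; have : nbhs (x, y) W by exact: open_nbhs_nbhs.
have oS x : open (xsection W x).
  rewrite openE => y /xsectionP/nW[[Q S] /= [Qx Sy] QSW].
  by apply: filterS Sy => z Sz; apply/xsectionP/QSW; split => //; exact: nbhs_singleton.
have cP : comeager_in H (\bigcap_(b in D) P b).
  apply: comeager_in_bigcap => [|b [Bb [bH b0]]].
    by apply: sub_countable cB; apply: subset_card_le => b [].
  apply: open_dense_comeager_in.
    rewrite openE => x [y yb /nW[[Q S] /= [Qx Sy] QSW]].
    apply: filterS Qx => z Qz; exists y => //; apply: QSW.
    by split => //; exact: nbhs_singleton.
  move=> V oV VH [v Vv]; have [w bw] := b0.
  have [| | |[x y] [[Vx bY] Wxy]] := dW (V `*` b).
  - rewrite openE => -[p q] [/= Vp bq]; exists (V, b) => //=.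
    by split; apply: open_nbhs_nbhs; split => //; exact: oB.
  - by move=> [x y] [/VH Hx /bH Hy].
  - by exists (v, w).
  - by exists x; split => //; exists y.
apply: comeager_inS cP => x Px; split => // V oV VH [v Vv].
have [b [Bb bv] bV] := bB v V (open_nbhs_nbhs (conj oV Vv)).
have [|y by_ Wxy] := Px b; first by split => //; split; [exact: subset_trans VH|exists v].
by exists y; split; [exact: bV|exact/xsectionP].
Qed.

(** For comeagerly many [x], the sections at [x] of the countably many dense open
    sets witnessing that [E] is comeager are all dense and open at once. *)
Lemma kuratowski_ulam (E : set (X * X)) :
  comeager_in (H `*` H) E ->
  comeager_in H [set x | comeager_in H (xsection E x)].
Proof.
move=> [G [cG hG] GE].
have : comeager_in H (\bigcap_(W in G)
    [set x | open (xsection W x) /\ dense_in H (xsection W x)] `&` H).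
  apply: comeager_inI; last by exists set0 => //; split => //.
  by apply: comeager_in_bigcap => // W /hG[oW dW]; exact: comeager_dense_sections.
apply: comeager_inS => x [hx Hx].
have : comeager_in H (\bigcap_(W in G) xsection W x `&` H).
  apply: comeager_inI; last by exists set0 => //; split => //.
  by apply: comeager_in_bigcap => // W /hx[]; exact: open_dense_comeager_in.
apply: comeager_inS => y [hy Hy].
by apply/xsectionP; apply: GE => // W /hy /xsectionP.
Qed.

End KuratowskiUlam.

(** A weak form of Mycielski's theorem, which replaces his Cantor scheme by a
    maximal set: a countable free set of points with comeager sections always
    extends by a point of the comeager intersection of these sections. *)
Lemma uncountable_free_set (R : realType) (X : pseudoMetricType R)
    (H : set X) (E : set (X * X)) :
  compact [set: X] -> open H -> H !=set0 -> comeager_in (H `*` H) E ->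
  (forall x y, E (x, y) -> E (y, x)) -> (forall x, ~ E (x, x)) ->
  exists2 D : set X, ~ countable D &
    forall x y, D x -> D y -> x <> y -> E (x, y).
Proof.
move=> cX oH H0 cE Esym Eirr.
have [x0 _] := H0.
have cR := kuratowski_ulam (compact_pseudometric_second_countable x0 cX) cE.
pose P (D : set X) := D `<=` [set x | comeager_in H (xsection E x)] /\
  forall x y, D x -> D y -> x <> y -> E (x, y).
have [|D [[DR DE] Dmax]] := @Zorn_bigcup X P.
  move=> F FP Ftot; split => [x [D /FP[DR _] /DR//]|x y [D FD Dx] [D' FD' D'y]].
  have [DD'|D'D] := Ftot D D' FD FD'.
  - by have [_] := FP _ FD'; apply => //; exact: DD'.
  - by have [_] := FP _ FD; apply => //; exact: D'D.
exists D => // cD.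
have := comeager_in_bigcap cD DR => /(comeager_inI cR).
move=> /(comeager_in_nonempty cX oH H0)[y [Hy [Ry Dy]]].
(* The point [y] lies in the section of [E] over every point of [D], so it could
   only belong to [D] if [(y, y)] were in [E]. *)
have nDy : ~ D y by move=> Dyy; apply: (@Eirr y); apply/xsectionP; exact: Dy.
apply: (Dmax (y |` D)).
  by split; [exact: subsetUr|move=> /(_ y) h; apply: nDy; apply: h; left].
split; first by move=> z [->|/DR].
move=> a b [->|Da] [->|Db] //.
- by move=> _; apply: Esym; apply/xsectionP; exact: Dy.
- by move=> _; apply/xsectionP; exact: Dy.
- exact: DE.
Qed.

(** * Lower and upper limits of real sequences *)

(** A single index [k] serves both as the time and as the inverse of the lower
    bound, since the right-hand condition gets weaker as [k] grows. This makes
    the set of distal pairs a union indexed by one natural number. *)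
Lemma limn_einf_gt0P (R : realType) (u : nat -> R) :
  (0%:E < limn_einf (EFin \o u))%E <->
  exists k : nat, forall n, (k <= n)%N -> k.+1%:R^-1 <= u n.
Proof.
rewrite limn_einf_lim; split => [|[k ku]].
  rewrite (cvg_lim _ (@cvg_einfs_sup R (EFin \o u)))//.
  move=> /ereal_sup_gt[_ [N _ <-]] /= N0.
  have [e e0 eN] : exists2 e : R, 0 < e & forall n, (N <= n)%N -> e <= u n.
    have ule n : (N <= n)%N -> (einfs (EFin \o u) N <= (u n)%:E)%E.
      by move=> Nn; apply: ereal_inf_lbound; exists n.
    move: N0 ule; rewrite /einfs /=; case: (ereal_inf _) => [r| |].
    - by rewrite lte_fin => r0 ule; exists r => // n /ule; rewrite lee_fin.
    - by move=> _ /(_ N (leqnn _)); rewrite leye_eq.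
    - by [].
  have [M] := @ltr_add_invr R 0 e e0; rewrite add0r => Me.
  exists (maxn M N) => n; rewrite geq_max => /andP[Mn Nn].
  apply: le_trans (eN _ Nn); apply: le_trans (ltW Me).
  by rewrite lef_pV2 ?posrE// ler_nat ltnS leq_maxl.
apply: (@lt_le_trans _ _ (k.+1%:R^-1)%:E); first by rewrite lte_fin invr_gt0.
apply: lime_ge; first exact: is_cvg_einfs.
exists k => // n /= kn; apply: le_ereal_inf_tmp => _ [m /= nm <-].
by rewrite lee_fin ku// (leq_trans kn).
Qed.

Lemma limn_esup_gt_io (R : realType) (u : nat -> R) (e : R) :
  (e%:E < limn_esup (EFin \o u))%E ->
  forall N, exists2 n, (N <= n)%N & e < u n.
Proof.
rewrite limn_esup_lim (cvg_lim _ (@cvg_esups_inf R (EFin \o u)))// => eu N.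
have : (e%:E < esups (EFin \o u) N)%E.
  by apply: lt_le_trans eu _; apply: ereal_inf_lbound; exists N.
by move=> /ereal_sup_gt[_ [n /= Nn <-]]; rewrite lte_fin; exists n.
Qed.

Lemma io_le_limn_esup (R : realType) (u : nat -> R) (e : R) :
  (forall N, exists2 n, (N <= n)%N & e < u n) ->
  (e%:E <= limn_esup (EFin \o u))%E.
Proof.
move=> eu; rewrite limn_esup_lim; apply: lime_ge; first exact: is_cvg_esups.
apply: nearW => N; have [n Nn enu] := eu N.
apply: (@le_trans _ _ (u n)%:E); first by rewrite lee_fin ltW.
by apply: ereal_sup_ubound; exists n.
Qed.

Lemma limn_einf_ge0 (R : realType) (u : nat -> \bar R) :
  (forall n, (0 <= u n)%E) -> (0 <= limn_einf u)%E.
Proof.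
move=> u0; rewrite limn_einf_lim; apply: lime_ge; first exact: is_cvg_einfs.
by apply: nearW => N; apply: le_ereal_inf_tmp => _ [n _ <-].
Qed.

Lemma mdist_continuous (R : realType) (X : metricType R) :
  continuous (fun p : X * X => mdist p.1 p.2 : R).
Proof.
move=> [x y]; apply/(@cvgrPdist_lt _ R^o) => e e0 /=.
have e2 : 0 < e / 2 by rewrite divr_gt0.
exists (ball x (e / 2), ball y (e / 2)) => /=.
  by split; exact: nbhsx_ballx.
move=> [a b] /=; rewrite !ballEmdist /= => -[xa yb].
have h1 := metric_triangle x a y; have h2 := metric_triangle a b y.
have h3 := metric_triangle a x b; have h4 := metric_triangle x y b.
rewrite (metric_sym b y) in h2; rewrite (metric_sym a x) in h3.
rewrite ltr_norml; apply/andP; split; lra.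
Qed.

(** * Distal and Li-Yorke pairs as sets of pairs *)

Section Dynamics.
Context (R : realType) (X : metricType R) (T : X -> X).
Hypothesis T_cont : continuous T.

Let rho (n : nat) (p : X * X) : R := mdist (iter n T p.1) (iter n T p.2).

Lemma rho_continuous n : continuous (rho n).
Proof.
have iT : continuous (iter n T).
  elim: n => [|n ih] x /=; first exact: cvg_id.
  by apply: (@continuous_comp _ _ _ (iter n T) T); [exact: ih|exact: T_cont].
move=> [x y].
apply: (@continuous_comp _ _ _ (fun p : X * X => (iter n T p.1, iter n T p.2))
  (fun p : X * X => mdist p.1 p.2)); last exact: mdist_continuous.
apply: cvg_pair; (apply: cvg_comp; last exact: iT); [exact: cvg_fst|exact: cvg_snd].
Qed.

Definition late_close (k : nat) : set (X * X) :=
  [set p | exists2 n, (k <= n)%N & rho n p < k.+1%:R^-1].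

Definition late_apart (e : R) (k : nat) : set (X * X) :=
  [set p | exists2 n, (k <= n)%N & e < rho n p].

Lemma late_close_open k : open (late_close k).
Proof.
have -> : late_close k =
    \bigcup_(n in [set n | (k <= n)%N]) rho n @^-1` [set r | r < k.+1%:R^-1].
  by apply/seteqP; split => p [n kn h]; exists n.
apply: bigcup_open => n _; apply: open_comp; last exact: open_lt.
by move=> p _; exact: rho_continuous.
Qed.

Lemma late_apart_open e k : open (late_apart e k).
Proof.
have -> : late_apart e k =
    \bigcup_(n in [set n | (k <= n)%N]) rho n @^-1` [set r | e < r].
  by apply/seteqP; split => p [n kn h]; exists n.
apply: bigcup_open => n _; apply: open_comp; last exact: open_gt.
by move=> p _; exact: rho_continuous.
Qed.

(** The complements of the open sets [late_close k] are closed, so this exhibits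
    [Dist] as an F_sigma set. *)
Lemma DistE : Dist T = \bigcup_k ~` late_close k.
Proof.
apply/seteqP; split => p.
  move=> /limn_einf_gt0P[k kp]; exists k => // -[n /kp].
  by rewrite leNgt => /negP.
move=> [k _ kp]; apply/limn_einf_gt0P; exists k => n kn.
by rewrite leNgt; apply/negP => h; apply: kp; exists n.
Qed.

(** Sensitivity yields [z] near [y] with [(y, z)] separated by more than [eps] at
    a late time; then [x] is separated by more than [eps / 2] from [y] or [z] at
    that time, so [(x, y)] or the nearby pair [(x, z)] is as wanted. *)
Lemma LYS_late_apart_dense (eps : R) (U : set (X * X)) (k : nat) :
  (forall x, exists2 u : nat -> X,
    (forall n, Li_Yorke_pair T eps x (u n)) & u n @[n --> \oo] --> x) ->
  dense_in U (late_apart (eps / 2) k).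
Proof.
move=> lys V oV _ [[x y] Vxy]; have [u uLY uy] := lys y.
have : nbhs (x, y) V by exact: open_nbhs_nbhs.
move=> [[A B] /= [Ax By] ABV].
have [N _ NB] := uy _ By; have /ABV Vxu : (A `*` B) (x, u N).
  by split; [exact: nbhs_singleton|exact: (NB N (leqnn _))].
have [_ /limn_esup_gt_io/(_ k)[n kn]] := uLY N.
have := metric_triangle (iter n T y) (iter n T x) (iter n T (u N)).
rewrite (metric_sym (iter n T y) (iter n T x)) => tri lt_eps.
have [le2|lt2] := leP (mdist (iter n T x) (iter n T y)) (eps / 2).
  by exists (x, u N); split => //; exists n => //; rewrite /rho /=; lra.
by exists (x, y); split => //; exists n.
Qed.

(** An open subset of [H `*` H] missing [late_close k] would consist of distal
    pairs. *)
Lemma interior_eq0_close_dense (H : set X) (k : nat) :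
  ((H `*` H) `&` Dist T)° = set0 -> dense_in (H `*` H) (late_close k).
Proof.
move=> int0 V oV VH [p Vp]; apply: contrapT => VC0.
have : V `<=` ((H `*` H) `&` Dist T)°.
  rewrite -open_subsetE// => q Vq; split; first exact: VH.
  by rewrite DistE; exists k => // Cq; apply: VC0; exists q.
by rewrite int0 => /(_ p Vp).
Qed.

End Dynamics.

(** * Category of the set of distal pairs and Li-Yorke chaos *)

(** An open set [W] inside the closure of [U `&` ~` C] meets [U]; by
    density of [C] in [U], the open set [U `&` W `&` C] is then nonempty, although
    it misses [U `&` ~` C]. *)
Lemma dense_in_setI_setC_nowhere_dense (Y : topologicalType) (U C : set Y) :
  open U -> open C -> dense_in U C -> nowhere_dense (U `&` ~` C).
Proof.
move=> oU oC dC; apply/seteqP; split => // p intp.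
have [q [[Uq _] intq]] : (U `&` ~` C) `&` (closure (U `&` ~` C))° !=set0.
  by apply: (interior_subset intp); exact: nbhs_interior.
have [||r [[Ur intr] Cr]] :=
    dC (U `&` (closure (U `&` ~` C))°) (openI oU (@open_interior _ _)).
- exact: subIsetl.
- by exists q.
- have [s [[_ nCs] Cs]] : (U `&` ~` C) `&` C !=set0.
    by apply: (interior_subset intr); exact: open_nbhs_nbhs.
  exact: nCs.
Qed.

(** If the interior were nonempty, Baire's theorem would give a point of it
    outside the closures of all the nowhere dense sets that cover it. *)
Lemma first_category_interior_eq0 (Y : uniformType) (A : set Y) :
  compact [set: Y] -> first_category A -> A° = set0.
Proof.
move=> cY [F nF ->]; apply: contrapT => /eqP/set0P U0.
have [|x [Ux nFx]] := @comeager_in_nonempty Y cY (\bigcup_n F n)°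
    (\bigcap_n ~` closure (F n)) (@open_interior _ _) U0.
  apply: comeager_in_bigcap => [|n _]; first exact: countableP.
  apply: open_dense_comeager_in; first exact: (closed_openC (@closed_closure _ _)).
  move=> V oV _ [v Vv]; apply: contrapT => VF.
  have : V `<=` (closure (F n))°.
    rewrite -open_subsetE// => y Vy; apply: contrapT => Fy.
    by apply: VF; exists y.
  by rewrite [X in _ `<=` X](nF n) => /(_ v Vv).
have [n _ Fnx] := interior_subset Ux.
by apply: (nFx n I); exact: subset_closure.
Qed.

Section DistBaire.
Context (R : realType) (X : metricType R) (T : X -> X) (H : set X).
Hypotheses (X_compact : compact [set: X]) (T_cont : continuous T).
Hypothesis H_open : open H.

Let HH_open : open (H `*` H).
Proof.
rewrite openE => -[x y] [/= Hx Hy]; exists (H, H) => //=.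
by split; exact: open_nbhs_nbhs.
Qed.

Lemma Dist_interior_eq0_iff_first_category :
  ((H `*` H) `&` Dist T)° = set0 <-> first_category ((H `*` H) `&` Dist T).
Proof.
split=> [int0|]; last first.
  apply: first_category_interior_eq0.
  by rewrite -setXTT; exact: compact_setX.
exists (fun k => (H `*` H) `&` ~` late_close T k).
  move=> k; apply: dense_in_setI_setC_nowhere_dense => //.
  - exact: late_close_open.
  - exact: interior_eq0_close_dense.
by rewrite DistE setI_bigcupr.
Qed.

Lemma LYS_interior_eq0_LYC :
  H !=set0 -> LYS T -> ((H `*` H) `&` Dist T)° = set0 ->
  exists2 eps : R, 0 < eps & LYC T eps.
Proof.
move=> H0 [eps eps0 lys] int0.
pose E : set (X * X) := \bigcap_k late_close T k `&` \bigcap_k late_apart T (eps / 2) k.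
have cE : comeager_in (H `*` H) E.
  apply: comeager_inI; apply: comeager_in_bigcap; rewrite ?countableP// => k _;
    apply: open_dense_comeager_in.
  - exact: late_close_open.
  - exact: interior_eq0_close_dense.
  - exact: late_apart_open.
  - exact: LYS_late_apart_dense.
have Esym x y : E (x, y) -> E (y, x).
  by move=> [cl ap]; split => k _; [have [n kn h] := cl k I|have [n kn h] := ap k I];
    exists n => //=; rewrite metric_sym.
have Eirr x : ~ E (x, x).
  move=> [_ /(_ 0%N I)[n _]]; rewrite /= mdistxx => h; lra.
have [D nD DE] := uncountable_free_set X_compact H_open H0 cE Esym Eirr.
(* The upper limit is only known to be at least [eps / 2]; any smaller constant
   makes the inequality strict. *)
exists (eps / 4); first lra.
exists D => // x y Dx Dy xy; have [cl ap] := DE x y Dx Dy xy; split.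
- apply/eqP; rewrite eq_le; apply/andP; split; last first.
    by apply: limn_einf_ge0 => n; rewrite lee_fin mdist_ge0.
  rewrite leNgt; apply/negP => dxy.
  have : Dist T (x, y) by [].
  by rewrite DistE => -[k _]; apply; exact: cl.
- apply: (@lt_le_trans _ _ (eps / 2)%:E); first by rewrite lte_fin; lra.
  by apply: io_le_limn_esup => N; exact: ap.
Qed.

End DistBaire.

Theorem theorem19 (R : realType) (X : metricType R) (T : X -> X)
    (T_tds : topological_dynamical_system T) (T_LYS : LYS T)
    (H : set X) (H_open : open H) (H_neq0 : H !=set0) :
  (interior ((H `*` H) `&` Dist T) = set0 <-> first_category ((H `*` H) `&` Dist T))
  /\
  (interior ((H `*` H) `&` Dist T) = set0 \/ first_category ((H `*` H) `&` Dist T) ->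
   exists2 eps : R, 0 < eps & LYC T eps).
Proof.
have [cX cT _] := T_tds.
have int0P := Dist_interior_eq0_iff_first_category cX cT H_open.
split=> // -[|/int0P]; exact: LYS_interior_eq0_LYC.
Qed.
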